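(* Let $G$ be a finite group, $k$ an algebraically closed field of characteristic $p\ge 0$, and $V$ a faithful finite-dimensional $kG$-module. Let $\chi_1,\dots,\chi_N$ be the irreducible Brauer characters of $G$ over $k$ (ordinary irreducible characters if $p=0$), and let $b(n)$ be the number of indecomposable summands of $V^{\otimes n}$, counted with multiplicity. (1) If the center $Z(G)$ is trivial, or $p>0$ and $Z(G)$ is a $p$-group, then the asymptotic growth rate is $$a(n)=\frac{1}{|G|}\sum_{t=1}^N\chi_t(1)\cdot(\dim V)^n,$$ that is, $b(n)\sim a(n)$. (2) In particular, if $p>0$ and $G$ is a $p$-group, then the asymptotic growth rate is $$a(n)=\frac{1}{|G|}(\dim V)^n .$$
   Context: $b(n)\sim a(n)$ means $b(n)/a(n)\to 1$ as $n\to\infty$; the ''asymptotic growth rate'' of $V$ is $a(n)$ with $b(n)\sim a(n)$. The value $\chi_t(1)$ is the dimension of the corresponding simple $kG$-module. *)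

(* Defs.v *)
From HB Require Import structures.
From mathcomp Require Import all_boot all_order all_fingroup all_algebra.
From mathcomp Require Import all_solvable all_field all_character.
From mathcomp Require Import classical_sets topology normedtype.
Set Implicit Arguments.
Unset Strict Implicit.
Unset Printing Implicit Defensive.
Import Order.TTheory GRing.Theory Num.Theory.
Import numFieldNormedType.Exports.
Local Open Scope group_scope.
Local Open Scope ring_scope.

Definition has_characteristic (k : fieldType) (p : nat) : Prop :=
  if p is 0%N then [pchar k] =i pred0 else p \in [pchar k].

Definition asymp_equiv (F : numFieldType) (b a : nat -> F) : Prop :=
  (b n / a n @[n --> \oo] --> (1 : F))%classic.

Section Modules.
Variables (k : fieldType) (gT : finGroupType) (G : {group gT}).

Section Decomposition.
Variables (m : nat) (rG : mx_representation k G m).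

Definition mx_indecomposable (U : 'M[k]_m) : Prop :=
  [/\ mxmodule rG U, U != 0 &
      forall W1 W2 : 'M[k]_m, mxmodule rG W1 -> mxmodule rG W2 ->
        (W1 + W2 :=: U)%MS -> mxdirect (W1 + W2) -> W1 = 0 \/ W2 = 0].

(* By the Krull-Schmidt theorem at most one c satisfies this. *)
Definition number_of_indecomposable_summands (c : nat) : Prop :=
  exists U : 'I_c -> 'M[k]_m,
    [/\ forall i, mx_indecomposable (U i),
        (\sum_i U i :=: 1%:M)%MS & mxdirect (\sum_i U i)].

End Decomposition.

Lemma trivial_mx_repr : mx_repr G (fun _ : gT => 1%:M : 'M[k]_1).
Proof. by split=> // x y _ _; rewrite mulmx1. Qed.
Definition trivial_repr := MxRepresentation trivial_mx_repr.

(* The degree is m ^ n, written so that successive degrees are convertible. *)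
Fixpoint tensor_power (m : nat) (rG : mx_representation k G m) (n : nat) :
    mx_representation k G (iter n (muln m) 1%N) :=
  if n is n'.+1 then prod_repr rG (tensor_power rG n') else trivial_repr.

Definition simple_modules (N : nat) (d : 'I_N -> nat)
    (S : forall t, mx_representation k G (d t)) : Prop :=
  [/\ forall t, mx_irreducible (S t),
      forall s t, mx_rsim (S s) (S t) -> s = t &
      forall n (rG : mx_representation k G n),
        mx_irreducible rG -> exists t, mx_rsim rG (S t)].

End Modules.

Section BrauerCharacters.
Variables (k : closedFieldType) (gT : finGroupType) (G : {group gT}).

Definition root_of_unity (x : k) : Prop := exists2 n, (0 < n)%N & x ^+ n = 1.

(* An embedding of the group of roots of unity of k (all of order prime to the
   characteristic) into that of the complex numbers. Only the values of theta
   at roots of unity matter. *)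
Definition Brauer_lift (theta : k -> algC) : Prop :=
  [/\ theta 1 = 1,
      forall x y, root_of_unity x -> root_of_unity y ->
        theta (x * y) = theta x * theta y &
      forall x y, root_of_unity x -> root_of_unity y ->
        theta x = theta y -> x = y].

Definition eigenvalue_seq (m : nat) (A : 'M[k]_m) : seq k :=
  sval (closed_field_poly_normal (char_poly A)).

Definition Brauer_character (theta : k -> algC) (m : nat)
    (rG : mx_representation k G m) (x : gT) : algC :=
  \sum_(z <- eigenvalue_seq (rG x)) theta z.

(* chi lists, without repetition, the irreducible Brauer characters, which are
   functions on the p-regular elements of G. If p = 0, then every element is
   p^'.-elt and these are the ordinary irreducible characters. *)
Definition irreducible_Brauer_characters (p : nat) (theta : k -> algC)
    (N : nat) (chi : 'I_N -> gT -> algC) : Prop :=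
  exists (d : 'I_N -> nat) (S : forall t, mx_representation k G (d t)),
    simple_modules S /\
    forall t x, x \in G -> (p^').-elt x ->
      chi t x = Brauer_character theta (S t) x.

End BrauerCharacters.

(* Main.v *)
Require Import Defs.
From mathcomp Require Import classical_sets topology normedtype.
From HB Require Import structures.
From mathcomp Require Import all_boot all_order all_fingroup all_algebra.
From mathcomp Require Import all_solvable all_field all_character.
From mathcomp Require Import zify.
Import Order.TTheory GRing.Theory Num.Theory.
Import numFieldNormedType.Exports.
Local Open Scope group_scope.
Local Open Scope ring_scope.

Set Implicit Arguments.
Unset Strict Implicit.
Unset Printing Implicit Defensive.


(** The group algebra [kG] is a projective module whose decomposition into
indecomposables has [s = \sum_t d t] terms, [d t] being the degree of the
simple module [S t], and for large [n] almost all of [V^{(x) n}] is a direct sum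
of copies of [kG].  If [V^{(x) n}] has a free summand of rank [f] and the
remaining dimension is [q = m ^ n - f * #|G|], then a decomposition into
indecomposables should have between [f * s] and [f * s + O(q)] terms; since
[q = o(m ^ n)] and [f] is then equivalent to [m ^ n / #|G|], the theorem
follows.

Counting summands.  For a simple module [S] and any module [M], let [T(S, M)] be the space of
relative traces [\sum_x x^-1 phi x] of linear maps [phi : S -> M]; these are
the homomorphisms [S -> M] that factor through a projective module.
The space [T(S, M)] is additive in [M].  When [M = U] is indecomposable, two
nonzero traces [S -> U] and [S' -> U] with independent images would give, by
taking the trace of a suitable endomorphism of the vector space [U], an
endomorphism of the module [U] that fixes the first image and kills the second,
against Fitting's lemma; hence [\sum_t \dim T(S_t, U)] is [0] or [1], and the
total dimension of the [T(S_t, M)] is the number of summands of the second kind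
(the projective ones).  That total lies between [f * s] and [f * s + q * s].
The sum of the other summands meets the free part trivially, because a simple
submodule of the free part is always the image of a relative trace; so there are
at most [q] of them.  This is [indecomposable_summands_bounds].

Free summands of tensor powers.  A free submodule is handled through a basis [B]
and a matrix [L] with [B x L = 0] for [x != 1] and [B L = 1]; the trace of
[L B] is then an equivariant projection onto the submodule that [B] generates.
The hypothesis on the centre ensures that no nontrivial element [z] of [G] acts
on [V] as a scalar, so that there are a vector [w] and a form [l] with [w l = 1]
and [w z l = 0]; for [z = 1], any pair with [w l = 1] will do.  Tensoring such
pairs over all [z] gives one vector generating a free submodule of [V^{(x) r}], [r = #|G|], and
tensoring them with a complement of the free part of [V^{(x) n}] turns the
complement dimension [q] into [q * (m ^ r - r)] at step [n + r], whereas all of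
[V^{(x) r}] has dimension [m ^ r].  The ratio [q / m ^ n] therefore decays
geometrically ([tensor_power_free_family]). *)

(** * Relative traces *)

Section RelativeTrace.
Variables (k : fieldType) (gT : finGroupType) (G : {group gT}).

Definition equivariant a b (rA : mx_representation k G a)
    (rB : mx_representation k G b) (j : 'M_(a, b)) :=
  forall x, x \in G -> rA x *m j = j *m rB x.

Definition relative_trace a b (rA : mx_representation k G a)
    (rB : mx_representation k G b) (phi : 'M_(a, b)) : 'M_(a, b) :=
  \sum_(x in G) rA x^-1%g *m phi *m rB x.

Variables (a b c : nat) (rA : mx_representation k G a)
  (rB : mx_representation k G b) (rC : mx_representation k G c).

Lemma relative_trace_is_linear : linear (relative_trace rA rB).
Proof.
move=> z u v; rewrite /relative_trace scaler_sumr -big_split /=.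
by apply: eq_bigr => x _; rewrite mulmxDr mulmxDl -scalemxAr -scalemxAl.
Qed.
HB.instance Definition _ := GRing.isLinear.Build k 'M_(a, b) 'M_(a, b) _
  (relative_trace rA rB) relative_trace_is_linear.

Lemma relative_trace_equivariant phi :
  equivariant rA rB (relative_trace rA rB phi).
Proof.
move=> y Gy; rewrite /relative_trace mulmx_sumr mulmx_suml.
rewrite (reindex_acts 'R _ Gy) ?astabsR //=; apply: eq_bigr => x Gx.
by rewrite !mulmxA -repr_mxM ?groupV ?groupM // invMg mulKVg repr_mxM ?mulmxA.
Qed.

Lemma mulmx_relative_trace (j : 'M_(a, b)) (phi : 'M_(b, c)) :
  equivariant rA rB j ->
  j *m relative_trace rB rC phi = relative_trace rA rC (j *m phi).
Proof.
move=> hj; rewrite /relative_trace mulmx_sumr; apply: eq_bigr => x Gx.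
by rewrite !mulmxA hj ?groupV.
Qed.

Lemma relative_trace_mulmx (phi : 'M_(a, b)) (g : 'M_(b, c)) :
  equivariant rB rC g ->
  relative_trace rA rB phi *m g = relative_trace rA rC (phi *m g).
Proof.
move=> hg; rewrite /relative_trace mulmx_suml; apply: eq_bigr => x Gx.
by rewrite -!mulmxA hg.
Qed.

End RelativeTrace.

(** * Fitting's lemma *)

Section Fitting.
Variables (k : fieldType) (gT : finGroupType) (G : {group gT}).
Variables (n : nat) (rG : mx_representation k G n).

Lemma expmx_equivariant (th : 'M_n) i :
  equivariant rG rG th -> equivariant rG rG (th ^+ i).
Proof.
move=> cth; elim: i => [|i IH] x Gx; first by rewrite expr0 mulmx1 mul1mx.
by rewrite exprS -mulmxE mulmxA cth // -!mulmxA IH.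
Qed.

Lemma equivariant_dom_hom m (W : 'M_(m, n)) (th : 'M_n) :
  equivariant rG rG th -> (W <= dom_hom_mx rG th)%MS.
Proof. by move=> cth; apply/hom_mxP => x Gx; rewrite -!mulmxA cth. Qed.

(** Fitting's lemma in the form used below: an endomorphism of an indecomposable
module that is the identity on one nonzero subspace is injective, since a
sufficiently high power splits the module into its image and its kernel. *)
Lemma indecomposable_endomorphism (U : 'M_n) (th : 'M_n) a a'
    (j : 'M_(a, n)) (j' : 'M_(a', n)) :
  mx_indecomposable rG U -> equivariant rG rG th -> (U *m th <= U)%MS ->
  (j <= U)%MS -> (j' <= U)%MS -> j *m th = j -> j' *m th = 0 ->
  j = 0 \/ j' = 0.
Proof.
move=> [modU nzU indU] cth sUth sjU sj'U jth j'th.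
pose r i := \rank (U *m th ^+ i).
(* The decreasing ranks repeat somewhere along the doubling sequence; the
   exponent must be positive for [j'] to lie in the kernel. *)
have [i i_gt0 ri] : exists2 i, (0 < i)%N & r (i + i)%N = r i.
  have r_le i : (r (i + i) <= r i)%N by rewrite /r exprD mulmxA mxrankM_maxl.
  suff stable v i : (0 < i)%N -> (r i < v)%N ->
      exists2 i, (0 < i)%N & r (i + i)%N = r i.
    exact: (stable _ 1%N isT (ltnSn _)).
  elim: v i => // v IH i i_gt0; rewrite ltnS => ri_le_v.
  have := r_le i; rewrite leq_eqVlt => /predU1P[ri | lt_r]; first by exists i.
  by apply: (IH (i + i)%N _ (leq_trans lt_r ri_le_v)); rewrite addn_gt0 i_gt0.
pose W1 := U *m th ^+ i; pose W2 := (U :&: kermx (th ^+ i))%MS.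
have homU : (U <= dom_hom_mx rG (th ^+ i))%MS.
  exact/equivariant_dom_hom/expmx_equivariant.
have sW1U : (W1 <= U)%MS.
  rewrite /W1; elim: (i) => [|l IH]; first by rewrite expr0 mulmx1.
  by rewrite exprSr mulmxA (submx_trans (submxMr _ IH)).
have W12 : (W1 :&: W2 = 0)%MS.
  apply/eqP; rewrite -submx0.
  apply: submx_trans (capmxS (submx_refl W1) (capmxSr U _)) _.
  rewrite submx0 -mxrank_eq0 -(eqn_add2l (r (i + i)%N)) {1}/r exprD mulmxA.
  by rewrite mxrank_mul_ker addn0 ri.
have jthl l : j *m th ^+ l = j.
  by elim: l => [|l IH]; rewrite ?expr0 ?mulmx1 // exprS mulmxA jth.
have sumW : (W1 + W2 :=: U)%MS.
  apply/eqmxP; rewrite -mxrank_leqif_eq ?addsmx_sub ?sW1U ?capmxSl //.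
  have := mxrank_sum_cap W1 W2; rewrite W12 mxrank0 addn0 => ->.
  by rewrite /W1 /W2 mxrank_mul_ker.
have [||//|W1_0|W2_0] := indU W1 W2 _ _ sumW.
- exact: hom_mxmodule.
- exact: kermx_hom_module.
- exact/mxdirect_addsP.
- by left; apply/eqP; rewrite -submx0 -W1_0 -(jthl i) submxMr.
right; apply/eqP; rewrite -submx0 -W2_0 sub_capmx sj'U; apply/sub_kermxP.
by rewrite -(prednK i_gt0) exprS mulmxA j'th mul0mx.
Qed.

End Fitting.

(** * Schur's lemma *)

Section Schur.
Variables (k : fieldType) (gT : finGroupType) (G : {group gT}).
Variables (a b : nat) (rA : mx_representation k G a)
  (rB : mx_representation k G b) (j : 'M[k]_(a, b)).
Hypothesis hom_j : equivariant rA rB j.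

Lemma equivariant_row_free : mx_irreducible rA -> j != 0 -> row_free j.
Proof.
move=> [_ _ irrA] nzj; rewrite -kermx_eq0; apply: contraR nzj => nzK.
have modK : mxmodule rA (kermx j).
  apply/mxmoduleP => x Gx; apply/sub_kermxP.
  by rewrite -mulmxA hom_j // mulmxA mulmx_ker mul0mx.
by rewrite -[j]mul1mx; apply/eqP/sub_kermxP/irrA; rewrite ?submx1.
Qed.

Lemma equivariant_row_full : mx_irreducible rB -> j != 0 -> row_full j.
Proof.
move=> [_ _ irrB] nzj; rewrite -sub1mx -(genmxE j).
rewrite irrB ?submx1 ?(eqmx_eq0 (genmxE _)) //.
rewrite (eqmx_module _ (genmxE _)).
by apply/mxmoduleP => x Gx; rewrite -hom_j // submxMl.
Qed.

Lemma equivariant_rsim :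
  mx_irreducible rA -> mx_irreducible rB -> j != 0 -> mx_rsim rA rB.
Proof.
move=> irrA irrB nzj; have fr := equivariant_row_free irrA nzj.
exists j => //; have /eqP <- := equivariant_row_full irrB nzj.
by move/eqP: fr.
Qed.

End Schur.

(** * Relative traces into an indecomposable module *)

Section Line.
Variables (k : closedFieldType) (gT : finGroupType) (G : {group gT}).
Variables (n : nat) (rG : mx_representation k G n).

(** If the images of [j] and [j'] were independent, some linear [al] with values
in [U] would satisfy [j al = phi] and [j' al = 0], and its trace would be an
endomorphism of [U] fixing [j] and killing [j']. *)
Lemma trace_images_meet U a a' (rA : mx_representation k G a)
    (rA' : mx_representation k G a') (phi : 'M_(a, n)) (phi' : 'M_(a', n)) :
  let j := relative_trace rA rG phi in let j' := relative_trace rA' rG phi' in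
  mx_indecomposable rG U -> mx_irreducible rA -> mx_irreducible rA' ->
  (phi <= U)%MS -> (phi' <= U)%MS -> j != 0 -> j' != 0 ->
  (j' :&: j)%MS != 0.
Proof.
move=> j j' indU irrA irrA' sphiU sphi'U nzj nzj'; apply/eqP => cap0.
have [modU _ _] := indU.
have homj : equivariant rA rG j by apply: relative_trace_equivariant.
have homj' : equivariant rA' rG j' by apply: relative_trace_equivariant.
have sub_trace b (rB : mx_representation k G b) (psi : 'M_(b, n)) :
    (psi <= U)%MS -> (relative_trace rB rG psi <= U)%MS.
  move=> spsiU; apply: summx_sub => x Gx; rewrite -mulmxA mulmx_sub //.
  by rewrite (submx_trans (submxMr _ spsiU)) // (mxmoduleP modU).
have fr : row_free (col_mx j' j).
  rewrite /row_free -addsmxE; have := mxrank_sum_cap j' j.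
  rewrite cap0 mxrank0 addn0 => ->.
  by rewrite (eqP (equivariant_row_free homj irrA nzj))
             (eqP (equivariant_row_free homj' irrA' nzj')).
pose al := pinvmx (col_mx j' j) *m col_mx 0 phi.
have : col_mx j' j *m al = col_mx 0 phi by rewrite mulmxA mulmxVp // mul1mx.
rewrite mul_col_mx => /eq_col_mx[j'al jal].
have sal : (al <= U)%MS.
  by rewrite mulmx_sub // -addsmxE addsmx_sub sub0mx.
pose th := relative_trace rG rG al.
have [||||//|||] := @indecomposable_endomorphism _ _ _ _ rG U th _ _ j j' indU.
- exact: relative_trace_equivariant.
- exact/mulmx_sub/sub_trace.
- exact: sub_trace.
- exact: sub_trace.
- by rewrite (mulmx_relative_trace _ _ homj) jal.
- by rewrite (mulmx_relative_trace _ _ homj') j'al linear0.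
- by apply/eqP.
- by apply/eqP.
Qed.

(** Two simple modules that meet coincide, and isomorphic modules of the list
[S] have the same index. *)
Lemma trace_line U N (d : 'I_N -> nat)
    (S : forall t, mx_representation k G (d t)) t t'
    (phi : 'M_(d t, n)) (phi' : 'M_(d t', n)) :
  let j := relative_trace (S t) rG phi in
  let j' := relative_trace (S t') rG phi' in
  simple_modules S -> mx_indecomposable rG U ->
  (phi <= U)%MS -> (phi' <= U)%MS -> j != 0 -> j' != 0 ->
  t' = t /\ (j' <= j)%MS.
Proof.
move=> j j' [irrS rsimS _] indU sphiU sphi'U nzj nzj'.
have homj : equivariant (S t) rG j by apply: relative_trace_equivariant.
have homj' : equivariant (S t') rG j' by apply: relative_trace_equivariant.
have nzcap := trace_images_meet indU (irrS t) (irrS t') sphiU sphi'U nzj nzj'.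
have sj'j : (j' <= j)%MS.
  (* [K] is the inverse image of [j] under [j'], a submodule of [S t']. *)
  pose K := kermx (j' *m cokermx j).
  have sKj : (K *m j' <= j)%MS by rewrite submxE -mulmxA mulmx_ker.
  have [_ _ irr] := irrS t'.
  have : (1%:M <= K)%MS.
    apply: irr; rewrite ?submx1 //.
      apply/mxmoduleP => x Gx; apply/sub_kermxP.
      have -> : K *m S t' x *m (j' *m cokermx j) = K *m j' *m rG x *m cokermx j.
        by rewrite mulmxA -(mulmxA K) homj' // !mulmxA.
      apply/eqP; rewrite -submxE (submx_trans (submxMr _ sKj)) // -homj //.
      exact: submxMl.
    apply: contraNneq nzcap => K0; rewrite -submx0; apply/rV_subP => v.
    rewrite sub_capmx => /andP[/submxP[w ->] wj].
    suff : (w <= K)%MS by rewrite K0 submx0 => /eqP->; rewrite mul0mx sub0mx.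
    by apply/sub_kermxP; rewrite mulmxA; apply/eqP; rewrite -submxE.
  move/(submxMr j'); rewrite mul1mx => /submx_trans; exact.
split=> //.
have /submxP[h j'E] := sj'j.
apply: rsimS; apply: (@equivariant_rsim _ _ _ _ _ _ _ h) => // [x Gx|].
  apply: (row_free_inj (equivariant_row_free homj (irrS t) nzj)).
  by rewrite -!mulmxA -j'E homj' // homj // j'E mulmxA.
by apply: contraNneq nzj' => h0; rewrite j'E h0 mul0mx.
Qed.

Lemma Schur_scalar a (rA : mx_representation k G a) (j j' : 'M_(a, n)) :
  mx_irreducible rA -> equivariant rA rG j -> equivariant rA rG j' ->
  (j' <= j)%MS -> j != 0 -> exists z, j' = z *: j.
Proof.
move=> irrA homj homj' /submxP[h j'E] nzj.
have /is_scalar_mxP[z hE] : is_scalar_mx h.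
  apply: (mx_abs_irr_cent_scalar (@group_closure_closed_field k gT G a rA irrA)).
  apply/centgmxP => x Gx.
  apply: (row_free_inj (equivariant_row_free homj irrA nzj)).
  by rewrite -!mulmxA -j'E homj' // homj // j'E mulmxA.
by exists z; rewrite j'E hE mul_scalar_mx.
Qed.

End Line.

(** * Free families *)

Section FreeFamilies.
Variables (k : fieldType) (gT : finGroupType) (G : {group gT}).
Variables (n : nat) (rG : mx_representation k G n).

(** The rows of [B] freely generate a submodule, and [L] provides the coordinate
forms: [u |-> u x^-1 L] reads off the coefficients of [u] on the translate
[B x]. *)
Definition free_family f (B : 'M[k]_(f, n)) (L : 'M[k]_(n, f)) :=
  forall x, x \in G -> B *m rG x *m L = (x == 1%g)%:R%:M.

Variables (f : nat) (B : 'M[k]_(f, n)) (L : 'M[k]_(n, f)).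
Hypothesis freeB : free_family B L.

Definition free_projection := relative_trace rG rG (L *m B).

Lemma free_projection_equivariant : equivariant rG rG free_projection.
Proof. exact: relative_trace_equivariant. Qed.

(** Only the term [x = 1] survives: a linear map into the span of [B] can be
recovered from its relative trace. *)
Lemma relative_trace_family a (rA : mx_representation k G a) (psi : 'M_(a, f)) :
  relative_trace rA rG (psi *m B) *m L = psi.
Proof.
rewrite /relative_trace mulmx_suml (bigD1 1%g) //= big1 => [|x /andP[Gx nx1]].
  rewrite addr0 invg1 !repr_mx1 mul1mx mulmx1 -mulmxA.
  by rewrite -[B]mulmx1 -(repr_mx1 rG) freeB // eqxx mulmx1.
by rewrite -!mulmxA (mulmxA B) freeB // (negPf nx1) raddf0 !mulmx0.
Qed.

Lemma family_projection : B *m free_projection = B.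
Proof.
rewrite /free_projection /relative_trace mulmx_sumr (bigD1 1%g) //= big1.
  rewrite addr0 invg1 repr_mx1 mul1mx mulmx1 mulmxA.
  by rewrite -[X in X *m L]mulmx1 -(repr_mx1 rG) freeB // eqxx mul1mx.
move=> x /andP[Gx nx1]; rewrite !mulmxA freeB ?groupV //.
by rewrite (eq_invg1 x) (negPf nx1) raddf0 !mul0mx.
Qed.

Lemma projection_family : free_projection *m L = L.
Proof. exact: relative_trace_family. Qed.

Lemma free_projection_idem :
  free_projection *m free_projection = free_projection.
Proof.
rewrite {1}/free_projection.
rewrite (relative_trace_mulmx _ _ free_projection_equivariant).
by rewrite -mulmxA family_projection.
Qed.

(** Homomorphisms into a free module are relative traces. *)
Lemma mulmx_free_projection a (rA : mx_representation k G a) (j : 'M_(a, n)) :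
  equivariant rA rG j ->
  j *m free_projection = relative_trace rA rG (j *m L *m B).
Proof. by move=> homj; rewrite (mulmx_relative_trace _ _ homj) mulmxA. Qed.

(** With the translates of [B] stacked into [R] and those of [L] into [R'], the
defining equations of a free family read [R R' = 1], while [R' R] is the
projection. *)
Lemma rank_free_projection : \rank free_projection = (f * #|G|)%N.
Proof.
pose g (i : 'I_#|G|) := enum_val i.
have Gg i : g i \in G by apply: enum_valP.
pose R := \mxcol_(i < #|G|) (B *m rG (g i)).
pose R' := \mxrow_(i < #|G|) (rG (g i)^-1%g *m L).
have R'R : R' *m R = free_projection.
  rewrite mul_mxrow_mxcol /free_projection /relative_trace.
  by rewrite [in RHS](big_enum_val) /=; apply: eq_bigr => i _; rewrite !mulmxA.
have RR' : R *m R' = 1%:M.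
  rewrite mul_mxcol_mxrow -mxdiagZ /mxdiag; apply: eq_mxblock => i i'.
  rewrite mulmxA -(mulmxA B) -repr_mxM ?groupV // freeB ?groupM ?groupV //.
  rewrite -eq_mulgV1 (inj_eq enum_val_inj); case: eqVneq => _.
    by rewrite conform_mx_id.
  exact: raddf0.
have <- : (\sum_(i < #|G|) f = f * #|G|)%N by rewrite sum_nat_const card_ord mulnC.
apply/eqP; rewrite eqn_leq -{1}R'R (leq_trans (mxrankM_maxl _ _)) ?rank_leq_col //=.
rewrite -{1}(mxrank1 k (\sum_(i < #|G|) f)) -[1%:M]mulmx1 -{2}RR' -RR' mulmxA.
by rewrite -(mulmxA R) R'R (leq_trans (mxrankM_maxl _ _)) // mxrankM_maxr.
Qed.

Definition free_complement := 1%:M - free_projection.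

Lemma rank_free_complement : \rank free_complement = (n - f * #|G|)%N.
Proof.
rewrite -rank_free_projection; apply/eqP; rewrite eqn_leq.
rewrite leq_subRL ?rank_leq_row // addnC leq_subLR mulmx0_rank_max /=.
  rewrite -[X in (X <= _)%N](mxrank1 k n) -[1%:M](subrK free_projection) addrC.
  exact: mxrank_add.
by rewrite mulmxBl mul1mx free_projection_idem subrr.
Qed.

End FreeFamilies.

(** * Counting indecomposable summands *)

Section DirectSum.
Variables (k : fieldType) (gT : finGroupType) (G : {group gT}).
Variables (n : nat) (rG : mx_representation k G n) (c : nat).
Variable U : 'I_c -> 'M[k]_n.
Hypothesis modU : forall i, mxmodule rG (U i).
Hypothesis sumU : (\sum_i U i :=: 1%:M)%MS.
Hypothesis dxU : mxdirect (\sum_i U i).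

Lemma direct_sum_projections : exists e : 'I_c -> 'M[k]_n,
  [/\ \sum_i e i = 1%:M, forall i, (e i <= U i)%MS,
      forall i i' m (A : 'M_(m, n)), (A <= U i)%MS ->
        A *m e i' = if i' == i then A else 0 &
      forall i, equivariant rG rG (e i)].
Proof.
pose U' i := (\sum_(i' | i' != i) U i')%MS.
have cap0 i : (U i :&: U' i = 0)%MS by apply: (mxdirect_sumsP dxU).
have sUU' i i' : i' != i -> (U i' <= U' i)%MS by move=> ni; apply: (sumsmx_sup i').
pose e i := proj_mx (U i) (U' i); exists e.
have eU i i' m (A : 'M_(m, n)) :
    (A <= U i)%MS -> A *m e i' = if i' == i then A else 0.
  move=> sAU; case: eqVneq => [->|ni]; first exact: proj_mx_id.
  by apply: proj_mx_0 => //; rewrite (submx_trans sAU) // sUU' // eq_sym.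
split=> // [|i|i]; last first.
- have homP : (1%:M <= dom_hom_mx rG (e i))%MS.
    apply: submx_trans (proj_mx_hom (cap0 i) (modU i) _); last first.
      exact: sumsmx_module.
    by rewrite -sumU (bigD1 i) //= addsmx_sub addsmxSl addsmxSr.
  by move=> x Gx; have := hom_mxP homP x Gx; rewrite !mul1mx.
- by rewrite -[e i]mul1mx proj_mx_sub.
have /sub_sumsmxP[u def1] : (1%:M <= \sum_i U i)%MS by rewrite sumU.
rewrite -[LHS]mul1mx {1 2}def1 mulmx_suml; apply: eq_bigr => i _.
rewrite mulmx_sumr (bigD1 i) //= (eU i) ?submxMl // eqxx big1 ?addr0 // => i' ni.
by rewrite (eU i) ?submxMl // (negPf ni).
Qed.

End DirectSum.

Section TraceSpaces.
Variables (k : fieldType) (gT : finGroupType) (G : {group gT}).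
Variables (n : nat) (rG : mx_representation k G n).
Variables (a : nat) (rA : mx_representation k G a).

Definition trace_space : {vspace 'M[k]_(a, n)} :=
  limg (linfun (relative_trace rA rG)).

(** For [e] the projection onto a summand [U] of the module, this is the space
of relative traces with values in [U]. *)
Definition trace_space_on (e : 'M[k]_n) : {vspace 'M[k]_(a, n)} :=
  (linfun (mulmxr e) @: trace_space)%VS.

Lemma mem_trace_space phi : relative_trace rA rG phi \in trace_space.
Proof. by rewrite -[relative_trace _ _ _]lfunE memv_img ?memvf. Qed.

Lemma trace_spaceP j :
  reflect (exists phi, j = relative_trace rA rG phi) (j \in trace_space).
Proof.
apply: (iffP memv_imgP) => [[phi _ ->]|[phi ->]]; exists phi.
- by rewrite lfunE.
- exact: memvf.
- by rewrite lfunE.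
Qed.

Lemma mem_trace_space_on e j : j \in trace_space -> j *m e \in trace_space_on e.
Proof.
by move=> Tj; rewrite -[j *m e]/(mulmxr e j) -[mulmxr e j]lfunE memv_img.
Qed.

Lemma trace_space_onP e j : equivariant rG rG e -> j \in trace_space_on e ->
  exists phi, j = relative_trace rA rG (phi *m e).
Proof.
move=> home /memv_imgP[_ /trace_spaceP[phi ->] ->]; exists phi.
by rewrite lfunE /= (relative_trace_mulmx _ _ home).
Qed.

Lemma dim_trace_space c (e : 'I_c -> 'M[k]_n) :
  (forall i, equivariant rG rG (e i)) -> \sum_i e i = 1%:M ->
  (forall i i', e i *m e i' = if i' == i then e i else 0) ->
  \dim trace_space = (\sum_i \dim (trace_space_on (e i)))%N.
Proof.
move=> home sum_e orth_e.
have dx : directv (\sum_i trace_space_on (e i)).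
  apply/directv_sum_independent => u Tu sum_u i _.
  have uE i' : u i' *m e i = if i == i' then u i' else 0.
    have /memv_imgP[j _ ->] := Tu i' isT; rewrite lfunE /= -mulmxA orth_e.
    by case: eqP => // _; rewrite mulmx0.
  move/(congr1 (mulmx^~ (e i))): sum_u; rewrite mul0mx mulmx_suml (bigD1 i) //=.
  rewrite uE eqxx big1 ?addr0 // => i' ni.
  by rewrite uE eq_sym (negPf ni).
have <- : (\sum_i trace_space_on (e i))%VS = trace_space.
  apply/eqP; rewrite eqEsubv; apply/andP; split.
    apply/subv_sumP => i _; apply/subvP => j /(trace_space_onP (home i))[phi ->].
    exact: mem_trace_space.
  apply/subvP => j Tj; rewrite -[j]mulmx1 -sum_e mulmx_sumr.
  by apply: memv_sumr => i _; apply: mem_trace_space_on.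
exact/directvP.
Qed.

Section Free.
Variables (f : nat) (B : 'M[k]_(f, n)) (L : 'M[k]_(n, f)).
Hypothesis freeB : free_family rG B L.

Lemma dim_trace_space_ge : (f * a <= \dim trace_space)%N.
Proof.
pose g : 'Hom('M[k]_(a, f), 'M_(a, n)) :=
  linfun (relative_trace rA rG \o mulmxr B).
have gE psi : g psi = relative_trace rA rG (psi *m B) by rewrite lfunE.
have ker0 : lker g == 0%VS.
  apply/lker0P => psi psi'; rewrite !gE => /(congr1 (mulmx^~ L)).
  by rewrite !relative_trace_family.
have -> : (f * a)%N = \dim (limg g).
  by rewrite limg_dim_eq ?(eqP ker0) ?capv0 // dimvf /dim /= mulnC.
apply/dimvS/subvP => _ /memv_imgP[psi _ ->]; rewrite gE; exact: mem_trace_space.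
Qed.

(** Every trace is a trace into the free part, which comes from a linear map
into the span of [B], plus the trace of a map into the complement [D]. *)
Lemma dim_trace_space_le : (\dim trace_space <= f * a + (n - f * #|G|) * a)%N.
Proof.
pose D := free_complement rG B L; pose C := row_base D.
pose g : 'Hom('M[k]_(a, f), 'M_(a, n)) :=
  linfun (relative_trace rA rG \o mulmxr B).
pose h : 'Hom('M[k]_(a, \rank D), 'M_(a, n)) :=
  linfun (relative_trace rA rG \o mulmxr C).
have sT : (trace_space <= limg g + limg h)%VS.
  apply/subvP => _ /trace_spaceP[phi ->].
  have -> : relative_trace rA rG phi =
      g (relative_trace rA rG phi *m L) + h (phi *m col_base D).
    rewrite !lfunE /= -(mulmxA phi) mulmx_base -mulmx_free_projection; last first.
      exact: relative_trace_equivariant.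
    rewrite (relative_trace_mulmx _ _ (free_projection_equivariant _ _ _)).
    by rewrite -linearD -mulmxDr addrC subrK mulmx1.
  by apply: memv_add; apply/memv_img/memvf.
have dim_img b (q : 'Hom('M[k]_(a, b), 'M_(a, n))) : (\dim (limg q) <= b * a)%N.
  have := limg_ker_dim q fullv; rewrite dimvf /dim /= mulnC => <-.
  exact: leq_addl.
apply: leq_trans (dimvS sT) _; apply: leq_trans (dimv_add_leqif _ _) _.
rewrite leq_add ?dim_img // (leq_trans (dim_img _ _)) //.
by rewrite leq_mul2r rank_free_complement ?leqnn ?orbT.
Qed.

End Free.

End TraceSpaces.

Section Counting.
Variables (k : closedFieldType) (gT : finGroupType) (G : {group gT}).
Variables (n : nat) (rG : mx_representation k G n).
Variables (N : nat) (d : 'I_N -> nat).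
Variable S : forall t, mx_representation k G (d t).
Hypothesis simS : simple_modules S.

Local Notation T t e := (trace_space_on rG (S t) e).

(** All nonzero traces into [U] come from a single simple module and are
proportional. *)
Lemma dim_trace_spaces_indecomposable U e :
  mx_indecomposable rG U -> equivariant rG rG e -> (e <= U)%MS ->
  (\sum_t \dim (T t e) = [exists t, T t e != 0%VS])%N.
Proof.
move=> indU home seU; have [irrS _ _] := simS.
have sphiU t (phi : 'M_(d t, n)) : (phi *m e <= U)%MS by apply: mulmx_sub.
have line t t' j j' : j \in T t e -> j' \in T t' e -> j != 0 -> j' != 0 ->
    t' = t /\ (j' <= j)%MS.
  move=> /(trace_space_onP home)[phi ->] /(trace_space_onP home)[phi' ->].
  exact: (trace_line simS indU (sphiU _ _) (sphiU _ _)).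
case: existsP => [[t nzT] | T0]; last first.
  rewrite big1 // => t _; apply/eqP; rewrite dimv_eq0.
  by apply/negPn/negP => nz; case: T0; exists t.
pose j := vpick (T t e).
have nzj : j != 0 by rewrite vpick0.
have Tj : j \in T t e by apply: memv_pick.
rewrite (bigD1 t) //= big1 => [|t' nt]; last first.
  apply/eqP; rewrite dimv_eq0; apply: contraNT nt; rewrite -vpick0 => nzj'.
  by have [-> _] := line _ _ _ _ Tj (memv_pick _) nzj nzj'.
have -> : T t e = <[j]>%VS; last by rewrite dim_vline nzj.
apply/eqP; rewrite eqEsubv -memvE Tj andbT; apply/subvP => j' Tj'.
have [->|nzj'] := eqVneq j' 0; first exact: mem0v.
have [_ sj'j] := line _ _ _ _ Tj Tj' nzj nzj'.
have homT j1 : j1 \in T t e -> equivariant (S t) rG j1.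
  move=> /(trace_space_onP home)[phi ->]; exact: relative_trace_equivariant.
have [z ->] := Schur_scalar (irrS t) (homT _ Tj) (homT _ Tj') sj'j nzj.
exact/memvZ/memv_line.
Qed.

Lemma simple_submodule (W : 'M[k]_n) : mxmodule rG W -> W != 0 ->
  exists t (j : 'M_(d t, n)),
    [/\ equivariant (S t) rG j, (j <= W)%MS & j != 0].
Proof.
move=> modW nzW; have [irrS _ allS] := simS.
have [X simX sXW] : exists2 X, mxsimple rG X & (X <= W)%MS.
  apply: boolp.contrapT => noX; suff: false by [].
  by apply: (mxsimple_exists modW nzW) => X; case: noX.
have [modX _ _] := simX.
have [t /mx_rsim_sym[h _ free_h homh]] := allS _ _ (proj2 (submod_mx_irr modX) simX).
exists t, (val_submod h); split=> [x Gx||].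
- by rewrite -(val_submodJ modX) // -homh // val_submodE mulmxA -val_submodE.
- exact: submx_trans (val_submodP _) sXW.
rewrite val_submod_eq0; apply: contraTneq free_h => ->.
rewrite /row_free mxrank0 eq_sym; have [_ + _] := irrS t.
by rewrite -mxrank_eq0 mxrank1.
Qed.

Variables (f : nat) (B : 'M[k]_(f, n)) (L : 'M[k]_(n, f)).
Hypothesis freeB : free_family rG B L.
Variable c : nat.
Hypothesis count_c : number_of_indecomposable_summands rG c.

(** The summands receiving a nonzero trace are counted by the dimensions of the
trace spaces; the sum [W] of the others is disjoint from the free part, so that
their number is at most the codimension of the free part. *)
Lemma indecomposable_summands_bounds :
  (f * \sum_t d t <= c <= f * \sum_t d t + (n - f * #|G|) * (\sum_t d t).+1)%N.
Proof.
have [U [indU sumU dxU]] := count_c.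
have modU i : mxmodule rG (U i) by case: (indU i).
have [e [sum_e seU eU home]] := direct_sum_projections modU sumU dxU.
pose proj i := [exists t, T t (e i) != 0%VS].
have orth_e i i' : e i *m e i' = if i' == i then e i else 0 by apply: eU.
have card_proj : (\sum_t \dim (trace_space rG (S t)) = #|proj|)%N.
  under eq_bigr do rewrite (dim_trace_space _ home sum_e orth_e).
  rewrite exchange_big -sum1_card [RHS]big_mkcond; apply: eq_bigr => i _.
  by rewrite (dim_trace_spaces_indecomposable (indU i) (home i)) // /proj.
have card_c : (c = #|proj| + #|[predC proj]|)%N by rewrite cardC card_ord.
pose W := (\sum_(i | ~~ proj i) U i)%MS.
have W_proj m (A : 'M_(m, n)) i : (A <= W)%MS -> proj i -> A *m e i = 0.
  move=> /sub_sumsmxP[u ->] proj_i; rewrite mulmx_suml big1 // => i' nproj_i'.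
  rewrite (eU i') ?submxMl //.
  by case: eqVneq proj_i => // -> proj_i'; rewrite proj_i' in nproj_i'.
(* A simple submodule of the intersection is the image of a trace [j], and the
   component of [j] along each summand vanishes: by directness on the summands
   outside [W], by the choice of [W] on the others. *)
have capW : (W :&: free_projection rG B L)%MS = 0.
  apply/eqP/negPn/negP => nzcap.
  have modcap : mxmodule rG (W :&: free_projection rG B L)%MS.
    rewrite capmx_module ?sumsmx_module //.
    rewrite -[free_projection _ _ _]mul1mx hom_mxmodule ?mxmodule1 //.
    exact/equivariant_dom_hom/free_projection_equivariant.
  have [t [j [homj]]] := simple_submodule modcap nzcap.
  rewrite sub_capmx => /andP[sjW sjF]; case/negP; apply/eqP.
  have /submxP[u jE] := sjF.
  have Tj : j \in trace_space rG (S t).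
    have -> : j = j *m free_projection rG B L.
      by rewrite jE -mulmxA free_projection_idem.
    by rewrite (mulmx_free_projection _ _ homj) mem_trace_space.
  rewrite -[j]mulmx1 -sum_e mulmx_sumr big1 // => i _.
  have [proj_i|nproj_i] := boolP (proj i); first exact: W_proj.
  have := mem_trace_space_on (e i) Tj; rewrite /proj negb_exists in nproj_i.
  by rewrite (eqP (negPn (forallP nproj_i t))) memv0 => /eqP.
have rankW : (\rank W + f * #|G| <= n)%N.
  rewrite -(rank_free_projection freeB).
  have := mxrank_sum_cap W (free_projection rG B L).
  by rewrite capW mxrank0 addn0 => <-; apply: rank_leq_col.
have card_nproj : (#|[predC proj]| <= \rank W)%N.
  pose W' := (\sum_(i | proj i) U i)%MS.
  have rank_sum : (\rank W + \rank W' >= n)%N.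
    rewrite -{1}(mxrank1 k n) -sumU (bigID proj) /= addnC.
    exact: leq_trans (mxrank_adds_leqif _ _) _.
  have rank_W' : (\rank W' <= \sum_(i | proj i) \rank (U i))%N.
    exact: mxrank_sum_leqif.
  have -> : #|[predC proj]| = (\sum_(i | ~~ proj i) 1)%N by rewrite sum1_card.
  apply: (@leq_trans (\sum_(i | ~~ proj i) \rank (U i))%N).
    by apply: leq_sum => i _; rewrite lt0n mxrank_eq0; case: (indU i).
  rewrite -(leq_add2l (\rank W')) [X in (_ <= X)%N]addnC.
  rewrite (leq_trans _ rank_sum) //.
  rewrite -[X in (_ <= X)%N](mxrank1 k n) -sumU (mxdirectP dxU).
  by rewrite [X in (_ <= X)%N](bigID proj) /= leq_add2r.
have ge_proj : (f * \sum_t d t <= #|proj|)%N.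
  rewrite -card_proj big_distrr /=; apply: leq_sum => t _.
  exact: (dim_trace_space_ge _ freeB).
have le_proj : (#|proj| <= f * (\sum_t d t) + (n - f * #|G|) * (\sum_t d t))%N.
  rewrite -card_proj !big_distrr -big_split /=.
  by apply: leq_sum => t _; exact: (dim_trace_space_le _ freeB).
rewrite {1 2}card_c (leq_trans ge_proj) ?leq_addr //=.
rewrite mulnSr addnA leq_add // (leq_trans card_nproj) //.
by rewrite leq_subRL ?(leq_trans (leq_addl _ _) rankW) // addnC.
Qed.

End Counting.

(** * Free families in tensor products *)

(** A nonzero entry [A i j] off the diagonal can be used to cancel [A i i]; for
a diagonal matrix with distinct entries [A i i] and [A j j], the sum of the two
basis vectors works. *)
Lemma non_scalar_separation (k : fieldType) m (A : 'M[k]_m) :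
  ~~ is_scalar_mx A ->
  exists (w : 'rV_m) (l : 'cV_m), w *m l = 1%:M /\ w *m A *m l = 0.
Proof.
have e2 i j : delta_mx 0 i *m delta_mx j 0 = (i == j)%:R%:M :> 'M[k]_1.
  rewrite mul_delta_mx_cond [RHS]mx11_scalar; apply/rowP => x.
  by rewrite ord1 !mxE; case: eqP => _; rewrite ?mulr1n ?mulr0n !mxE.
have eA i j : delta_mx 0 i *m A *m delta_mx j 0 = (A i j)%:M :> 'M[k]_1.
  by apply/rowP => x; rewrite ord1 -rowE -colE !mxE.
move=> nsA.
have [/existsP[i /existsP[j /andP[nij nzA]]] | diag] :=
    boolP [exists i, exists j, (i != j) && (A i j != 0)].
  exists (delta_mx 0 i), (delta_mx i 0 - (A i i / A i j) *: delta_mx j 0).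
  rewrite !mulmxBr -!scalemxAr !e2 !eA eqxx (negPf nij) raddf0 scaler0 subr0.
  by rewrite scale_scalar_mx divfK ?subrr.
have offdiag i j : i != j -> A i j = 0.
  move=> nij; apply/eqP/negPn/negP => nzA; case/negP: diag.
  by apply/existsP; exists i; apply/existsP; exists j; rewrite nij.
have [/existsP[i /existsP[j nA]] | const] :=
    boolP [exists i, exists j, A i i != A j j].
  have nij : i != j by apply: contraNneq nA => ->.
  have nzd : A i i - A j j != 0 by rewrite subr_eq0.
  pose u := (A i i - A j j)^-1.
  exists (delta_mx 0 i + delta_mx 0 j),
    ((A i i * u) *: delta_mx j 0 - (A j j * u) *: delta_mx i 0).
  have [Aij Aji] : A i j = 0 /\ A j i = 0 by rewrite !offdiag // eq_sym.
  rewrite !mulmxDl !mulmxBr -!scalemxAr !e2 !eA Aij Aji !eqxx (eq_sym j) (negPf nij).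
  rewrite !scale_scalar_mx !mulr0 !mulr1 !raddf0 !(subr0, sub0r).
  rewrite !addr0 ![- _ + _]addrC (mulrAC (A i i) u) (mulrAC (A j j) u).
  rewrite (mulrC (A j j) (A i i)) subrr.
  by rewrite -raddfB /= -mulrBl mulfV.
case/negP: nsA; apply/is_scalar_mxP.
case: m A {e2 eA} diag offdiag const => [|m] A _ offdiag const.
  by exists 0; rewrite [A]flatmx0 [RHS]flatmx0.
exists (A 0 0); apply/matrixP => i j; rewrite !mxE; case: eqVneq => [<-|/offdiag//].
rewrite mulr1n; apply/eqP/negPn/negP => nA; case/negP: const.
by apply/existsP; exists i; apply/existsP; exists 0.
Qed.

Section Tensor.
Variables (k : fieldType) (gT : finGroupType) (G : {group gT}).

Lemma tprod0l (m1 n1 m2 n2 : nat) (B : 'M[k]_(m2, n2)) :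
  tprod (0 : 'M[k]_(m1, n1)) B = 0.
Proof.
elim: m1 n1 => [|m1 IH] n1 //=.
by rewrite !linear0 IH -trowbE linear0 col_mx0.
Qed.

Lemma tprod0r (m1 n1 m2 n2 : nat) (A : 'M[k]_(m1, n1)) :
  tprod A (0 : 'M[k]_(m2, n2)) = 0.
Proof. by elim: m1 A => [|m1 IH] A //=; rewrite linear0 IH col_mx0. Qed.

(** A free family [(B, L)] together with dual bases [(C, C')] of a complement of
dimension [q] of the free part.  The list [s] records the elements [x]
for which [C] has already been made independent of its translate [C x]; once it
contains all of [G], the rows of [C] can be added to the free family. *)
Definition almost_free n (rG : mx_representation k G n) f q (s : seq gT) :=
  exists (B : 'M[k]_(f, n)) (L : 'M[k]_(n, f))
         (C : 'M[k]_(q, n)) (C' : 'M[k]_(n, q)),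
  [/\ free_family rG B L, C *m C' = 1%:M &
      forall x, x \in G ->
      [/\ B *m rG x *m C' = 0, C *m rG x *m L = 0 &
         x \in s -> x != 1%g -> C *m rG x *m C' = 0]].

Variables (n : nat) (rG : mx_representation k G n).

Lemma almost_free_start f (B : 'M[k]_(f, n)) (L : 'M[k]_(n, f)) :
  free_family rG B L -> almost_free rG f (n - f * #|G|) [::].
Proof.
move=> freeB; pose E := free_projection rG B L.
pose D := free_complement rG B L.
have EE : E *m E = E by apply: free_projection_idem.
have homE : equivariant rG rG E by apply: free_projection_equivariant.
have DD : D *m D = D by rewrite mulmxBl mul1mx mulmxBr mulmx1 EE subrr subr0.
have rankD : \rank D = (n - f * #|G|)%N := rank_free_complement freeB.
move: (row_base D) (col_base D) (row_base_free D) (col_base_full D)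
  (mulmx_base D); rewrite rankD => C C' freeC /row_fullP[X XC'] C'C.
have CC' : C *m C' = 1%:M.
  apply: (row_free_inj freeC); rewrite mul1mx -[LHS]mul1mx -[RHS]mul1mx -XC'.
  by rewrite -!mulmxA (mulmxA C') C'C DD.
have C'E : C' = D *m C' by rewrite -C'C -mulmxA CC' mulmx1.
have CE : C = C *m D by rewrite -C'C mulmxA CC' mul1mx.
have homD : equivariant rG rG D.
  by move=> x Gx; rewrite mulmxBl mulmxBr mul1mx mulmx1 homE.
exists B, L, C, C'; split=> // x Gx; split=> //.
  rewrite C'E mulmxA -(mulmxA B) homD // mulmxA.
  by rewrite mulmxBr mulmx1 family_projection // subrr !mul0mx.
rewrite CE -(mulmxA C) -homD // -!mulmxA.
by rewrite mulmxBl mul1mx projection_family // subrr !mulmx0.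
Qed.

Lemma almost_free_end f q s :
  almost_free rG f q s -> {subset G <= s} ->
  exists (B : 'M[k]_(f + q, n)) L, free_family rG B L.
Proof.
move=> [B [L [C [C' [freeB CC' ortho]]]]] sGs.
exists (col_mx B C), (row_mx L C') => x Gx.
rewrite mul_col_mx mul_col_row freeB //.
have [-> -> /(_ (sGs x Gx))] := ortho x Gx.
have [->|_ ->//] := eqVneq x 1%g; last by rewrite !raddf0 block_mx0.
by rewrite repr_mx1 mulmx1 CC' scalar_mx_block.
Qed.

(** The free family grows by tensoring it with a basis of [V]; the complement
keeps its dimension, and its bases are tensored with a vector [w] and a form [l]
that separate [w] from its translate by [z], which adds [z] to the list [s]. *)
Lemma almost_free_tensor m (V : mx_representation k G m) f q s z :
  (0 < m)%N -> (z != 1%g -> ~~ is_scalar_mx (V z)) ->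
  almost_free rG f q s -> almost_free (prod_repr V rG) (m * f) q (z :: s).
Proof.
move=> m_gt0 nsV [B [L [C [C' [freeB CC' ortho]]]]].
have [w [l [wl wzl]]] : exists (w : 'rV_m) (l : 'cV_m),
    w *m l = 1%:M /\ (z != 1%g -> w *m V z *m l = 0).
  have [z1|/nsV/non_scalar_separation[w [l [wl wzl]]]] := eqVneq z 1%g; last first.
    by exists w, l.
  exists (delta_mx 0 (Ordinal m_gt0)), (delta_mx (Ordinal m_gt0) 0).
  split=> //; rewrite mul_delta_mx; apply/rowP => i.
  by rewrite !ord1 !mxE eqxx.
rewrite -[q]mul1n.
exists (tprod 1%:M B), (tprod 1%:M L), (tprod w C), (tprod l C').
split=> [x Gx||x Gx].
- rewrite /= -!tprodE mul1mx mulmx1 freeB //.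
  case: eqVneq => [->|_]; first by rewrite repr_mx1 tprod1.
  by rewrite raddf0 tprod0r raddf0.
- by rewrite -tprodE wl CC' tprod1.
have [BC' CL C0] := ortho x Gx.
rewrite /= -!tprodE BC' CL !tprod0r; split=> //.
rewrite inE => /predU1P[-> /wzl-> | sx nx1]; first by rewrite tprod0l.
by rewrite C0 // tprod0r.
Qed.

End Tensor.

(** * Free families in tensor powers *)

Lemma tensor_power_degree m n : iter n (muln m) 1%N = (m ^ n)%N.
Proof. by elim: n => [|n IH] //=; rewrite IH expnS. Qed.

Section TensorPowers.
Variables (k : fieldType) (gT : finGroupType) (G : {group gT}).
Variables (m : nat) (V : mx_representation k G m).
Hypothesis m_gt0 : (0 < m)%N.
Hypothesis nsV : forall x, x \in G -> x != 1%g -> ~~ is_scalar_mx (V x).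

Definition has_free_rank n f := exists (B : 'M_(f, iter n (muln m) 1%N)) L,
  free_family (tensor_power V n) B L.

(** Tensoring once for each element of [G] makes the complement generate a free
module of rank its dimension. *)
Lemma free_step n f : has_free_rank n f ->
  has_free_rank (#|G| + n) (m ^ #|G| * f + (m ^ n - f * #|G|)).
Proof.
case=> B [L freeB].
have tensor_all (s : seq gT) : {subset s <= G} ->
    almost_free (tensor_power V (size s + n)) (m ^ size s * f)
      (m ^ n - f * #|G|) s.
  elim: s => [_|z s IH sG].
    by rewrite mul1n -tensor_power_degree; apply: almost_free_start freeB.
  rewrite [size _]/= expnS -mulnA.
  apply: (almost_free_tensor (rG := tensor_power V (size s + n))) => //.
    by apply: nsV; rewrite sG ?mem_head.
  by apply: IH => x sx; rewrite sG // inE sx orbT.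
have /tensor_all : {subset enum G <= G} by move=> x; rewrite mem_enum.
by rewrite -cardE => /almost_free_end; apply=> x Gx; rewrite mem_enum.
Qed.

Lemma free_le n f : has_free_rank n f -> (f * #|G| <= m ^ n)%N.
Proof.
case=> B [L /rank_free_projection <-].
by rewrite -tensor_power_degree rank_leq_col.
Qed.

Lemma free0 n : has_free_rank n 0.
Proof. by exists 0, 0 => x _; apply/matrixP => [[]]. Qed.

Lemma card_le_expn : (#|G| <= m ^ #|G|)%N.
Proof.
have := free_le (free_step (free0 0)).
by rewrite muln0 mul0n subn0 expn0 mul1n addn0.
Qed.

(** Each block of [#|G|] tensor factors multiplies the dimension of the
complement by [m ^ #|G| - #|G|]. *)
Lemma tensor_power_free_family n : exists f,
  has_free_rank n f /\
  (f * #|G| + m ^ (n %% #|G|) * (m ^ #|G| - #|G|) ^ (n %/ #|G|) = m ^ n)%N.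
Proof.
suff main j i : exists f, has_free_rank (j * #|G| + i) f /\
    (f * #|G| + m ^ i * (m ^ #|G| - #|G|) ^ j = m ^ (j * #|G| + i))%N.
  by have := main (n %/ #|G|)%N (n %% #|G|)%N; rewrite -divn_eq.
elim: j => [|j [f [freef def_f]]].
  by exists 0%N; split; [exact: free0 | rewrite mul0n muln1].
exists (m ^ #|G| * f + (m ^ (j * #|G| + i) - f * #|G|))%N; split.
  by rewrite mulSn -addnA; apply: free_step freef.
rewrite -{1}def_f addKn mulSn -[in RHS]addnA expnD -def_f expnS.
have := card_le_expn; set R := (m ^ #|G|)%N; set g := #|G|.
set Q := (m ^ i)%N; set P := (_ ^ j)%N; move=> leR.
rewrite -{1 3}(subnK leR); move: (R - g)%N => e; nia.
Qed.

End TensorPowers.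

(** An element acting as a scalar [a] is central; if the centre is a [p]-group,
then [a] has order a power of [p], so that [a = 1] in characteristic [p]. *)
Lemma faithful_non_scalar (k : fieldType) (p : nat) (gT : finGroupType)
    (G : {group gT}) m (V : mx_representation k G m) :
  has_characteristic k p -> (0 < m)%N -> mx_faithful V ->
  'Z(G) = 1%g :> {set gT} \/ (0 < p)%N /\ p.-group 'Z(G) ->
  forall x, x \in G -> x != 1%g -> ~~ is_scalar_mx (V x).
Proof.
move=> k_char m_gt0 faithV Zcond x Gx nx1; apply/negP => /is_scalar_mxP[a Vx].
have Zx : x \in 'Z(G).
  apply/centerP; split=> // y Gy; apply: (mx_faithful_inj faithV); rewrite ?groupM //.
  by rewrite !repr_mxM // Vx scalar_mxC.
case: Zcond nx1 => [Z1|[p_gt0 pZ]]; first by move: Zx; rewrite Z1 inE => ->.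
case/eqP; apply: (mx_faithful_inj faithV) => //.
have [e oxE] := p_natP (mem_p_elt pZ Zx).
have pk : p \in [pchar k] by case: (p) p_gt0 k_char.
have a1 : a ^+ (p ^ e) = 1.
  have VxX l : V (x ^+ l)%g = (a ^+ l)%:M.
    elim: l => [|l IH]; first by rewrite expg0 repr_mx1 expr0.
    by rewrite expgS repr_mxM ?groupX // IH Vx -scalar_mxM exprS.
  have := VxX #[x].
  rewrite -oxE expg_order repr_mx1 => /matrixP/(_ (Ordinal m_gt0) (Ordinal m_gt0)).
  by rewrite !mxE eqxx.
have : (a - 1) ^+ (p ^ e) = 0.
  have pe : [pchar k].-nat (p ^ e)%N by rewrite pnatX pnatE ?(pcharf_prime pk) ?pk.
  by rewrite exprDn_pchar // exprNn_pchar // a1 expr1n subrr.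
by move/eqP; rewrite expf_eq0 subr_eq0 => /andP[_ /eqP a_1]; rewrite Vx a_1 repr_mx1.
Qed.

(** * Degrees of the simple modules *)

Lemma trivial_repr_irr (k : fieldType) (gT : finGroupType) (G : {group gT}) :
  mx_irreducible (trivial_repr k G).
Proof. exact/mx_abs_irrW/linear_mx_abs_irr. Qed.

Lemma trivial_action_rsim (k : fieldType) (gT : finGroupType) (G : {group gT})
    a b (rA : mx_representation k G a) (rB : mx_representation k G b) :
  a = b -> {in G, forall x, rA x = 1%:M} -> {in G, forall x, rB x = 1%:M} ->
  mx_rsim rA rB.
Proof.
move=> eq_ab; subst b => A1 B1; exists 1%:M => // [|x Gx].
  by rewrite row_free_unit unitmx1.
by rewrite A1 ?B1.
Qed.

Section SumOfDegrees.
Variables (k : closedFieldType) (gT : finGroupType) (G : {group gT}).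
Variables (N : nat) (d : 'I_N -> nat) (S : forall t, mx_representation k G (d t)).
Hypothesis simS : simple_modules S.

Lemma sum_degrees_gt0 : (0 < \sum_t d t)%N.
Proof.
have [irrS _ allS] := simS.
have [t _] := allS _ _ (trivial_repr_irr k G).
rewrite (bigD1 t) //= addn_gt0; apply/orP; left.
by have /mx_irrP[] := irrS t.
Qed.

(** A [p]-group acts trivially on simple modules in characteristic [p], so that
the trivial module is the only one. *)
Lemma sum_degrees_pgroup p : p \in [pchar k] -> p.-group G -> \sum_t d t = 1%N.
Proof.
move=> pk pG; have [irrS rsimS allS] := simS.
have S1 t x : x \in G -> S t x = 1%:M.
  have := subsetP (pcore_sub_rker_mx_irr_pchar pk (irrS t)) x.
  by rewrite pcore_pgroup_id // => sub_ker /sub_ker/rkerP[].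
have d1 t : d t = 1%N.
  have /mx_irrP[d_gt0 fullS] := irrS t.
  have /eqP <- : row_full (delta_mx (Ordinal d_gt0) (Ordinal d_gt0) : 'M[k]_(d t)).
    apply: fullS.
      by apply/mxmoduleP => x Gx; rewrite S1 // mulmx1.
    by rewrite -mxrank_eq0 mxrank_delta.
  by rewrite mxrank_delta.
have [t0 _] := allS _ _ (trivial_repr_irr k G).
rewrite (bigD1 t0) //= d1 big1 // => t; case/eqP; apply: rsimS.
by apply: trivial_action_rsim; [rewrite !d1 | exact: S1 | exact: S1].
Qed.

End SumOfDegrees.

Lemma Brauer_character1 (k : closedFieldType) (gT : finGroupType)
    (G : {group gT}) (theta : k -> algC) m (rG : mx_representation k G m) :
  theta 1 = 1 -> Brauer_character theta rG 1%g = m%:R.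
Proof.
move=> theta1; rewrite /Brauer_character /eigenvalue_seq repr_mx1.
case: closed_field_poly_normal => s /= def_s.
have char1 : char_poly (1%:M : 'M[k]_m) = ('X - 1%:P) ^+ m.
  by rewrite /char_poly /char_poly_mx map_scalar_mx -raddfB det_scalar.
have monic1 : lead_coef (char_poly (1%:M : 'M[k]_m)) = 1.
  exact/eqP/char_poly_monic.
rewrite monic1 scale1r in def_s.
have size_s : size s = m.
  by have := size_char_poly (1%:M : 'M[k]_m); rewrite def_s size_prod_XsubC => -[].
rewrite -size_s -sum1_size natr_sum big_seq [RHS]big_seq; apply: eq_bigr => z sz.
have : root (char_poly (1%:M : 'M[k]_m)) z by rewrite def_s root_prod_XsubC.
rewrite char1; case: (m) => [|l]; first by rewrite expr0 (negPf (root1 _)).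
by rewrite root_exp_XsubC => /eqP->.
Qed.

(** * Asymptotics *)

(** Bernoulli's inequality [(1 + 1/D) ^ j >= 1 + j/D], cleared of
denominators. *)
Lemma expn_Bernoulli D j : (D ^ j * (D + j) <= D.+1 ^ j * D)%N.
Proof.
elim: j => [|j IH]; first by rewrite addn0.
rewrite !expnS -!mulnA; apply: leq_trans _ (leq_mul (leqnn D.+1) IH).
rewrite mulnCA (mulnCA D.+1) leq_mul2l; apply/orP; right; nia.
Qed.

Lemma expn_decay R g j :
  (0 < g)%N -> (0 < R)%N -> ((R - g) ^ j * j.+1 <= R ^ j * R)%N.
Proof.
move=> g_gt0; case: R => // D _.
have le_D : (D.+1 - g <= D)%N by rewrite leq_subLR; lia.
apply: (@leq_trans (D ^ j * j.+1)).
  by case: j => // j; rewrite leq_mul2r leq_exp2r ?le_D.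
case: D le_D => [_|D _]; first by case: j => // j; rewrite exp0n.
apply: leq_trans (leq_trans (expn_Bernoulli D.+1 j) _); rewrite leq_mul2l.
  by rewrite addSn ltnS leq_addl orbT.
by rewrite leqnSn orbT.
Qed.

(** With [c = s * m ^ n / g], the bounds give [|b n - c| <= q * s.+1], and
[q / m ^ n] tends to [0] because [n %/ g] tends to infinity. *)
Lemma asymp_equiv_bounds (b : nat -> nat) (m g s R : nat) :
  (0 < m)%N -> (0 < g)%N -> (0 < s)%N ->
  (forall n, exists f q, [/\ (f * g + q = m ^ n)%N,
     (q * (n %/ g).+1 <= m ^ n * R)%N & (f * s <= b n <= f * s + q * s.+1)%N]) ->
  asymp_equiv (fun n => (b n)%:R : algC) (fun n => g%:R^-1 * s%:R * m%:R ^+ n).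
Proof.
move=> m_gt0 g_gt0 s_gt0 bounds; apply/cvgrPdist_lt => eps eps_gt0.
pose K := (s.+1 * g * R)%N.
(* Beyond [t * g] the relative error, at most [K / (n %/ g).+1], is below
   [eps]. *)
have [t K_lt] : exists t : nat, K%:R / eps < t%:R.
  by exists (Num.bound (K%:R / eps)); rewrite archi_boundP ?divr_ge0 ?ler0n ?ltW.
exists (t * g)%N => // n /= le_n.
have le_t : (t <= n %/ g)%N by rewrite leq_divRL.
have [f [q [def_m q_small /andP[b_ge b_le]]]] := bounds n.
pose A := (s * m ^ n)%N; pose D := `|A%:Z - (b n * g)%:Z|%N.
have D_le : (D <= q * (s.+1 * g))%N.
  have A_def : A = (f * s * g + q * s)%N.
    by rewrite /A -def_m mulnDr (mulnC s q) mulnCA mulnA (mulnC f) mulnAC.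
  have sg : (q * s <= q * (s.+1 * g))%N by rewrite leq_mul2l; nia.
  have := leq_mul b_ge (leqnn g); have := leq_mul b_le (leqnn g).
  rewrite /D A_def mulnDl -(mulnA q); lia.
have key : (D * (n %/ g).+1 <= m ^ n * K)%N.
  apply: leq_trans (leq_mul D_le (leqnn _)) _.
  rewrite mulnAC mulnC /K [(m ^ n * _)%N]mulnCA leq_mul2l.
  by rewrite q_small orbT.
have A_gt0 : 0 < A%:R :> algC by rewrite ltr0n muln_gt0 s_gt0 expn_gt0 m_gt0.
have -> : 1 - (b n)%:R / (g%:R^-1 * s%:R * m%:R ^+ n) =
    (A%:R - (b n * g)%:R) / A%:R :> algC.
  rewrite mulrBl divff ?(gt_eqF A_gt0) // !natrM natrX !invfM invrK.
  by rewrite -!mulrA; congr (_ - _ * _); rewrite mulrA mulrCA mulrA.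
have -> : A%:R - (b n * g)%:R = (A%:Z - (b n * g)%:Z)%:~R :> algC by rewrite rmorphB.
rewrite normrM normfV (gtr0_norm A_gt0) ltr_pdivrMr // -intr_norm -/D.
have j_gt0 : 0 < (n %/ g).+1%:R :> algC by rewrite ltr0n.
rewrite -(ltr_pM2r j_gt0).
have key' : D%:R * (n %/ g).+1%:R <= A%:R * K%:R :> algC.
  by rewrite -!natrM ler_nat (leq_trans key) // leq_mul2r leq_pmull ?orbT.
apply: le_lt_trans key' _; rewrite mulrAC mulrC ltr_pM2r //.
rewrite ltr_pdivrMr // mulrC in K_lt; apply: lt_le_trans K_lt _.
by rewrite ler_pM2l // ler_nat ltnW.
Qed.

Unset Implicit Arguments.

Theorem corollary2
    (k : closedFieldType) (p : nat) (gT : finGroupType) (G : {group gT})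
    (m : nat) (V : mx_representation k G m)
    (theta : k -> algC) (N : nat) (chi : 'I_N -> gT -> algC)
    (b : nat -> nat)
    (k_char : has_characteristic k p)
    (V_neq0 : (0 < m)%N)
    (V_faithful : mx_faithful V)
    (theta_lift : Brauer_lift theta)
    (chi_irr : irreducible_Brauer_characters G p theta chi)
    (b_count : forall n,
       number_of_indecomposable_summands (tensor_power V n) (b n)) :
  (('Z(G) = 1%g :> {set gT} \/ (0 < p)%N /\ p.-group 'Z(G)) ->
     asymp_equiv (fun n => (b n)%:R : algC)
       (fun n => (#|G|%:R)^-1 * (\sum_(t < N) chi t 1%g) * m%:R ^+ n))
  /\
  ((0 < p)%N /\ p.-group G ->
     asymp_equiv (fun n => (b n)%:R : algC)
       (fun n => (#|G|%:R)^-1 * m%:R ^+ n)).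
Proof.
have [d [S [simS chiE]]] := chi_irr.
have [theta1 _ _] := theta_lift.
have sum_chi : \sum_(t < N) chi t 1%g = (\sum_t d t)%:R.
  rewrite natr_sum; apply: eq_bigr => t _.
  by rewrite chiE ?group1 ?p_elt1 // Brauer_character1.
have growth : 'Z(G) = 1%g :> {set gT} \/ (0 < p)%N /\ p.-group 'Z(G) ->
    asymp_equiv (fun n => (b n)%:R : algC)
      (fun n => (#|G|%:R)^-1 * (\sum_t d t)%:R * m%:R ^+ n).
  move=> Zcond.
  have nsV := faithful_non_scalar k_char V_neq0 V_faithful Zcond.
  have s_gt0 := sum_degrees_gt0 simS.
  apply: (asymp_equiv_bounds (R := (m ^ #|G|)%N) V_neq0 (cardG_gt0 G) s_gt0) => n.
  have [f [[B [L freeB]] def_q]] := tensor_power_free_family V_neq0 nsV n.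
  set q := (m ^ (n %% #|G|) * _)%N in def_q.
  exists f, q; split=> //.
    rewrite /q [in X in (_ <= X)%N](divn_eq n #|G|) expnD.
    have R_gt0 : (0 < m ^ #|G|)%N by rewrite expn_gt0 V_neq0.
    rewrite [(n %/ _ * _)%N]mulnC expnM [X in (_ <= X * _)%N]mulnC -!mulnA.
    by rewrite leq_mul2l expn_decay ?orbT.
  have := indecomposable_summands_bounds simS freeB (b_count n).
  by rewrite tensor_power_degree -def_q addKn.
split=> [Zcond|[p_gt0 pG]]; first by rewrite sum_chi; apply: growth.
have pk : p \in [pchar k] by case: (p) p_gt0 k_char.
have := growth (or_intror (conj p_gt0 (pgroupS (center_sub G) pG))).
by rewrite (sum_degrees_pgroup simS pk pG) mulr1.
Qed.
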